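(* Let $(\Sigma_A^+,d,\sigma)$ be a subshift of finite type generated by a $k\times k$ incidence matrix $A$. Then for every $\alpha\ge0$: (1) for every $E\subset\Sigma_A^+$, $\dim_H(E,d)=\dfrac{h^{\alpha,B}_{top}(\sigma,E)}{1+\alpha}$, where $\dim_H(E,d)$ is the Hausdorff dimension of $E$ with respect to $d$; (2) $h^{\alpha,B}_{top}(\sigma,\Sigma_A^+)=h^\alpha_{top}(\sigma,\Sigma_A^+)=(1+\alpha)\log r(A)$, where $r(A)$ is the spectral radius of $A$. Consequently $\dim_H(\Sigma_A^+,d)=\log r(A)$.
   Context: $\Sigma_k^+=\{0,\dots,k-1\}^{\mathbb N}$ (coordinates $x=(x_0,x_1,\dots)$) with metric $d(x,y)=e^{-n(x,y)}$, where $n(x,y)$ is the first index at which $x$ and $y$ disagree ($n(x,x)=\infty$); $\sigma$ is the left shift. $A$ is a $k\times k$ matrix with entries in $\{0,1\}$, each row containing at least one $1$, and $\Sigma_A^+=\{x\in\Sigma_k^+: A_{x_n,x_{n+1}}=1\ \forall n\}$ with $\sigma$ restricted to it. For a TDS $(X,d,f)$ (compact metric space, continuous map), $d_n^\alpha(x,y)=\max_{0\le i\le n-1}e^{\alpha i}d(f^ix,f^iy)$, $B_n^\alpha(x,\varepsilon)=\{y: d_n^\alpha(x,y)<\varepsilon\}$. $\alpha$-Bowen topological entropy of $K\subset X$: $M^\alpha(K,s,\varepsilon,n)=\inf\sum_i e^{-sn_i}$ over finite or countable families $\{B^\alpha_{n_i}(x_i,\varepsilon)\}$ with $n_i\ge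 n$ covering $K$; $M^\alpha(K,s,\varepsilon)=\lim_n M^\alpha(K,s,\varepsilon,n)$; $M^\alpha(K,\varepsilon)=\inf\{s: M^\alpha(K,s,\varepsilon)=0\}$; $h^{\alpha,B}_{top}(f,K)=\lim_{\varepsilon\to0}M^\alpha(K,\varepsilon)$. $\alpha$-topological entropy: a set $E\subset X$ is $(n,\alpha,\varepsilon)$-spanning if every $x\in X$ has $y\in E$ with $d_n^\alpha(x,y)<\varepsilon$; $r_n(f,\alpha,X,\varepsilon)$ is the minimal cardinality of such a set; $h^\alpha_{top}(f,X)=\lim_{\varepsilon\to0}\limsup_{n\to\infty}\frac1n\log r_n(f,\alpha,X,\varepsilon)$. *)

(* Defs.v *)
From HB Require Import structures.
From mathcomp Require Import all_boot all_order all_algebra.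
From mathcomp Require Import all_classical all_reals all_analysis.
From mathcomp Require Import complex.
From mathcomp Require Import finmap.
Set Implicit Arguments. Unset Strict Implicit. Unset Printing Implicit Defensive.
Import Order.TTheory GRing.Theory Num.Theory.
Local Open Scope classical_set_scope.
Local Open Scope ring_scope.

Definition dist_n_alpha {R : realType} {T : choiceType} (d : T -> T -> R) (f : T -> T)
    (alpha : R) (n : nat) (x y : T) : R :=
  \big[Num.max/0]_(i < n) (expR (alpha * i%:R) * d (iter i f x) (iter i f y)).

Definition bowen_ball {R : realType} {T : choiceType} (X : set T) (d : T -> T -> R)
    (f : T -> T) (alpha : R) (n : nat) (x : T) (eps : R) : set T :=
  [set y | X y /\ dist_n_alpha d f alpha n x y < eps].

Definition bowen_M_n {R : realType} {T : choiceType} (X : set T) (d : T -> T -> R)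
    (f : T -> T) (alpha : R) (K : set T) (s eps : R) (n : nat) : \bar R :=
  ereal_inf [set z : \bar R | exists (D : set nat) (c : nat -> T) (m : nat -> nat),
    (forall i, D i -> X (c i) /\ (n <= m i)%N) /\
    K `<=` \bigcup_(i in D) bowen_ball X d f alpha (m i) (c i) eps /\
    z = (\esum_(i in D) (expR (- s * (m i)%:R))%:E)%E].

Definition bowen_M {R : realType} {T : choiceType} (X : set T) (d : T -> T -> R)
    (f : T -> T) (alpha : R) (K : set T) (s eps : R) : \bar R :=
  lim ((fun n => bowen_M_n X d f alpha K s eps n) @ \oo).

Definition bowen_crit {R : realType} {T : choiceType} (X : set T) (d : T -> T -> R)
    (f : T -> T) (alpha : R) (K : set T) (eps : R) : \bar R :=
  ereal_inf [set (s%:E)%E | s in [set s : R | 0 <= s /\ bowen_M X d f alpha K s eps = 0%E]].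

Definition bowen_entropy {R : realType} {T : choiceType} (X : set T) (d : T -> T -> R)
    (f : T -> T) (alpha : R) (K : set T) : \bar R :=
  lim ((fun eps => bowen_crit X d f alpha K eps) @ 0^'+).

Definition spanning {R : realType} {T : choiceType} (X : set T) (d : T -> T -> R)
    (f : T -> T) (alpha : R) (n : nat) (eps : R) (E : set T) : Prop :=
  E `<=` X /\ forall x, X x -> exists y, E y /\ dist_n_alpha d f alpha n x y < eps.

Definition span_number {R : realType} {T : choiceType} (X : set T) (d : T -> T -> R)
    (f : T -> T) (alpha : R) (n : nat) (eps : R) : \bar R :=
  ereal_inf [set (((#|` fset_set E|)%fset%:R : R)%:E)%E
            | E in [set E : set T | finite_set E /\ spanning X d f alpha n eps E]].

Definition top_entropy {R : realType} {T : choiceType} (X : set T) (d : T -> T -> R)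
    (f : T -> T) (alpha : R) : \bar R :=
  lim ((fun eps => limn_esup
          (fun n => (ln (fine (span_number X d f alpha n eps)) / n%:R)%:E)) @ 0^'+).

Definition diam {R : realType} {T : choiceType} (d : T -> T -> R) (U : set T) : R :=
  sup [set d p.1 p.2 | p in U `*` U].

Definition hausdorff_content {R : realType} {T : choiceType} (X : set T)
    (d : T -> T -> R) (s delta : R) (E : set T) : \bar R :=
  ereal_inf [set z : \bar R | exists (D : set nat) (U : nat -> set T),
    (forall i, D i -> U i `<=` X /\ diam d (U i) <= delta) /\
    E `<=` \bigcup_(i in D) U i /\
    z = (\esum_(i in D) (powR (diam d (U i)) s)%:E)%E].

Definition hausdorff_measure {R : realType} {T : choiceType} (X : set T)
    (d : T -> T -> R) (s : R) (E : set T) : \bar R :=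
  lim ((fun delta => hausdorff_content X d s delta E) @ 0^'+).

Definition hausdorff_dim {R : realType} {T : choiceType} (X : set T)
    (d : T -> T -> R) (E : set T) : \bar R :=
  ereal_inf [set (s%:E)%E | s in [set s : R | 0 <= s /\ hausdorff_measure X d s E = 0%E]].

Definition seqk (k : nat) := nat -> 'I_k.

Definition sigma_shift {k : nat} (x : seqk k) : seqk k := fun n => x n.+1.

(* n(x,y): first index where x and y disagree (None = infinity, x = y) *)
Definition first_diff {k : nat} (x y : seqk k) : option nat :=
  match pselect (exists n, (fun m => x m != y m) n) with
  | left H => Some (ex_minn H)
  | right _ => None
  end.

Definition shift_dist {R : realType} {k : nat} (x y : seqk k) : R :=
  match first_diff x y with
  | Some n => expR (- n%:R)
  | None => 0
  end.

Definition SigmaA {k : nat} (A : 'M[nat]_k) : set (seqk k) :=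
  [set x | forall n, A (x n) (x n.+1) = 1%N].

Definition spectral_radius {R : realType} {k : nat} (A : 'M[nat]_k) : R :=
  sup [set Normc.normc z | z in
        [set z : R[i] | eigenvalue (map_mx (fun a : nat => (a%:R : R[i])) A) z]].

(* Main.v *)
(* A Bowen ball B_n^alpha(x, eps) with eps <= 1 is the cylinder of x of length
   about (1 + alpha)(n - 1) - ln eps, and a set of diameter r lies in a cylinder
   of length about - ln r.  Up to a constant, the cost e^(-s n) of the ball is
   therefore diam^(s / (1 + alpha)), so at every scale eps <= 1 the critical
   exponent of the Bowen sums is (1 + alpha) dim_H.

   The number W_n of admissible words of length n grows like r(A)^n: from below
   by an eigenvector, from above by the Cayley-Hamilton theorem.  Covering by all
   cylinders of length n gives dim_H <= ln r(A).  Conversely, by compactness a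
   cover by cylinders of cost sum e^(-s |w|) <= 1 may be taken finite; every long
   admissible word starts with a word w of the cover followed by an admissible
   word, so W_N <= sum_w W_(N - |w|), whence W_N = O(e^(s N)) and ln r(A) <= s. *)
Require Import Defs.
From HB Require Import structures.
From mathcomp Require Import all_boot all_order all_algebra finmap.
From mathcomp Require Import all_classical all_reals all_analysis.
From mathcomp Require Import complex.
From mathcomp Require Import ring lra.
Set Implicit Arguments.
Unset Strict Implicit.
Import Order.TTheory GRing.Theory Num.Theory numFieldNormedType.Exports.
Local Open Scope classical_set_scope.
Local Open Scope ring_scope.

(** * Cylinders and Bowen balls *)

Definition agree {k : nat} (n : nat) (x y : seqk k) : Prop :=
  forall i, (i < n)%N -> x i = y i.

Section Distance.
Context {R : realType} {k : nat}.
Implicit Types (x y : seqk k).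
Local Notation dist := (@shift_dist R k).

Lemma agree_sym n x y : agree n x y -> agree n y x.
Proof. by move=> xy i /xy ->. Qed.

Lemma agree_trans n x y z : agree n x y -> agree n y z -> agree n x z.
Proof. by move=> xy yz i ni; rewrite (xy i ni) (yz i ni). Qed.

Lemma iter_shiftE i x j : iter i sigma_shift x j = x (i + j)%N.
Proof. by elim: i j => // i IH j /=; rewrite /sigma_shift IH addSnnS. Qed.

Lemma agree_iter i n x y : agree n x y ->
  agree (n - i) (iter i sigma_shift x) (iter i sigma_shift y).
Proof. by move=> xy j; rewrite ltn_subRL => /xy; rewrite !iter_shiftE. Qed.

Lemma shift_dist_leP n x y : dist x y <= expR (- n%:R) <-> agree n x y.
Proof.
rewrite /shift_dist /Defs.first_diff; case: pselect => [H|H].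
  case: ex_minnP => m xym minm; rewrite ler_expR lerN2 ler_nat; split.
    move=> nm i ni; apply/eqP/negPn/negP => /minm mi.
    by move: (leq_trans ni nm); rewrite ltnNge mi.
  by move=> ag; rewrite leqNgt; apply/negP => mn; move: xym; rewrite (ag m mn) eqxx.
split=> [_ i _|_]; last exact: expR_ge0.
by apply/eqP/negPn/negP => xy; apply: H; exists i.
Qed.

Lemma shift_dist_ge0 x y : 0 <= dist x y.
Proof. by rewrite /shift_dist; case: Defs.first_diff => // n; exact: expR_ge0. Qed.

Lemma shift_dist_gtr x y j : x j <> y j -> expR (- j%:R) <= dist x y.
Proof.
move=> xyj; rewrite /shift_dist /Defs.first_diff; case: pselect => [H|[]].
  case: ex_minnP => m xym minm; rewrite ler_expR lerN2 ler_nat.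
  by apply: minm; apply/eqP.
by exists j; apply/eqP.
Qed.

(** If [x] and [y] first differ at [m >= n], the last time [n - 1] dominates in the Bowen metric and
    contributes [exp((1 + alpha)(n - 1) - m)]. For [0 <= alpha] and [0 < eps <= 1], this depth is
    the least [m] that brings the value below [eps]. *)
Definition ball_depth (alpha eps : R) (n : nat) : nat :=
  (Num.truncn ((1 + alpha) * n.-1%:R - ln eps)).+1.

Lemma ball_depth_gt (alpha eps : R) n :
  (1 + alpha) * n.-1%:R - ln eps < (ball_depth alpha eps n)%:R.
Proof. exact: truncnS_gt. Qed.

Lemma ball_depth_le (alpha eps : R) n : 0 <= alpha -> 0 < eps <= 1 ->
  (ball_depth alpha eps n)%:R <= (1 + alpha) * n.-1%:R - ln eps + 1.
Proof.
move=> a0 /andP[e0 e1]; rewrite -natr1 lerD2r truncn_le.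
rewrite addr_ge0 ?oppr_ge0 ?ln_le0// mulr_ge0 ?ler0n//; lra.
Qed.

Lemma ball_depth_geq (alpha eps : R) n : 0 <= alpha -> 0 < eps <= 1 ->
  (n <= ball_depth alpha eps n)%N.
Proof.
case: n => // n a0 /andP[e0 e1]; rewrite ltnS; suff H : n%:R <= (1 + alpha) * n%:R - ln eps.
  by rewrite truncn_ge_nat// (le_trans _ H).
have : 0 <= alpha * n%:R by rewrite mulr_ge0.
  have := ln_le0 e1; lra.
Qed.

Lemma dist_n_alpha_ltP (alpha eps : R) n x y : 0 <= alpha -> 0 < eps <= 1 ->
  (0 < n)%N ->
  dist_n_alpha dist sigma_shift alpha n x y < eps <->
  agree (ball_depth alpha eps n) x y.
Proof.
move=> a0 e01; have /andP[e0 e1] := e01; case: n => // n _; split.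
  move=> /bigmax_ltP[_ H] j jL.
  have nterm i : (i <= n)%N ->
    dist (iter i sigma_shift x) (iter i sigma_shift y) < expR (ln eps - alpha * i%:R).
    move=> ni; have /= := H (Ordinal (ni : (i < n.+1)%N)) isT.
    by rewrite expRB lnK ?posrE// ltr_pdivlMr ?expR_gt0// mulrC.
  (* A disagreement this early puts the shifted points at distance 1 at time [i], which [eps <= 1]
     forbids. *)
  have xyn i : (i <= n)%N -> x i = y i.
    move=> ni; apply: contrapT => xyi.
    have : iter i sigma_shift x 0%N <> iter i sigma_shift y 0%N.
      by rewrite !iter_shiftE addn0.
    move=> /shift_dist_gtr /le_lt_trans /(_ (nterm i ni)).
    rewrite ltr_expR.
    have : 0 <= alpha * i%:R by rewrite mulr_ge0.
    have := ln_le0 e1; lra.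
  have [jn|nj] := leqP j n; first exact: xyn.
  (* A later disagreement is best seen from the last time [n], where position [j] has moved to
     [j - n]. *)
  apply: contrapT => xyj.
  have : iter n sigma_shift x (j - n)%N <> iter n sigma_shift y (j - n)%N.
    by rewrite !iter_shiftE subnKC// ltnW.
  move=> /shift_dist_gtr /le_lt_trans /(_ (nterm n (leqnn n))).
  rewrite ltr_expR natrB ?(ltnW nj)//.
  move: jL; rewrite ltnS /= => jL.
  have := ball_depth_le n.+1 a0 e01; rewrite -natr1 lerD2r /=.
  move: jL; rewrite -(ler_nat R) /=; set T := (_%:R : R) => jL; lra.
move=> xy; apply/bigmax_ltP; split=> // i _.
have /(shift_dist_leP _ _ _).2 := agree_iter (i := i) xy.
have inL : (i <= ball_depth alpha eps n.+1)%N.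
  by rewrite ltnW// (leq_trans (ltn_ord i))// ball_depth_geq.
rewrite natrB// => h.
apply: (@le_lt_trans _ _ (expR (alpha * i%:R + - ((ball_depth alpha eps n.+1)%:R - i%:R)))).
  by rewrite expRD ler_wpM2l// expR_ge0.
rewrite -[ltRHS]lnK ?posrE// ltr_expR.
have := @ball_depth_gt alpha eps n.+1 => /=.
have : (1 + alpha) * i%:R <= (1 + alpha) * n%:R.
  by rewrite ler_wpM2l ?ler_nat ?leq_ord//; lra.
lra.
Qed.

End Distance.

(** * Growth of matrix powers *)

(** The value [C / (r - l)] is the fixed point of [K |-> (l K + C) / r]. Adding [|a 0|] covers the
    initial term and preserves the induction because [l < r]. *)
Lemma geometric_recurrence_bound (R : realFieldType) (a : nat -> R) (l r C : R) :
  0 <= l -> l < r -> 0 <= C -> (forall n, a n.+1 <= l * a n + C * r ^+ n) ->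
  exists2 K, 0 <= K & forall n, a n <= K * r ^+ n.
Proof.
move=> l0 lr C0 step; have rl : 0 < r - l by rewrite subr_gt0.
have K0 : 0 <= C / (r - l) + `|a 0%N| by rewrite addr_ge0 ?divr_ge0// ltW.
exists (C / (r - l) + `|a 0%N|) => //; elim=> [|n IH].
  by rewrite expr0 mulr1 (le_trans (ler_norm _))// lerDr divr_ge0// ltW.
apply: (le_trans (step n)); apply: (le_trans (lerD (ler_wpM2l l0 IH) (lexx _))).
rewrite exprS !mulrA -mulrDl ler_wpM2r ?exprn_ge0//; first lra.
rewrite [leRHS]mulrC -subr_ge0.
have -> : r * (C / (r - l) + `|a 0%N|) - (l * (C / (r - l) + `|a 0%N|) + C) =
    (r - l) * `|a 0%N| by field; rewrite gt_eqF.
by rewrite mulr_ge0// ltW.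
Qed.

Section MatrixGrowth.
Context {R : realType} {n : nat}.
Implicit Types (M : 'M[R[i]]_n.+1) (r : R).
Local Notation normc := (@Normc.normc R).

Lemma normc_ge0 (z : R[i]) : 0 <= normc z.
Proof. by case: z => a b; exact: sqrtr_ge0. Qed.

Lemma ler_normcD (x y : R[i]) : normc (x + y) <= normc x + normc y.
Proof. exact: (@le_normcD R x y). Qed.

Lemma normcX (z : R[i]) m : normc (z ^+ m) = normc z ^+ m.
Proof.
elim: m => [|m IH]; first by rewrite !expr0 Normc.normc1.
by rewrite !exprS Normc.normcM IH.
Qed.

Lemma normc_nat m : normc (m%:R : R[i]) = m%:R.
Proof. by have := @normcMn R (1 : R[i]) m; rewrite Normc.normc1. Qed.

Lemma ler_normc_sum (I : Type) (s : seq I) (P : pred I) (F : I -> R[i]) :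
  normc (\sum_(i <- s | P i) F i) <= \sum_(i <- s | P i) normc (F i).
Proof.
elim/big_rec2: _ => [|i y1 y2 _ le12]; first by rewrite Normc.normc0.
by rewrite (le_trans (ler_normcD _ _))// lerD2l.
Qed.

(* Peeling off one factor ['X - z] at a time turns the annihilating
   polynomial into scalar first order recurrences. *)
Lemma horner_mx_growth M (s : seq R[i]) (q : {poly R[i]}) i j r : 0 < r ->
  (forall z, z \in s -> normc z < r) ->
  horner_mx M (q * \prod_(z <- s) ('X - z%:P)) = 0 ->
  exists2 K, 0 <= K & forall m, normc (horner_mx M (q * 'X^m) i j) <= K * r ^+ m.
Proof.
move=> r0; elim: s q => [|z s IH] q sr.
  rewrite big_nil mulr1 => q0; exists 0 => // m.
  by rewrite rmorphM /= q0 mul0r mxE Normc.normc0 mul0r.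
rewrite big_cons mulrA => /IH[w ws|K K0 qK].
  by apply: sr; rewrite in_cons ws orbT.
apply: (@geometric_recurrence_bound _ _ (normc z) r K) => //.
- exact: normc_ge0.
- by apply: sr; rewrite mem_head.
move=> m; have -> : q * 'X^(m.+1) = z%:P * (q * 'X^m) + q * ('X - z%:P) * 'X^m.
  by rewrite exprS; ring.
rewrite rmorphD rmorphM /= horner_mx_C -mulmxE mul_scalar_mx mxE.
rewrite (le_trans (ler_normcD _ _))// lerD//.
by rewrite mxE Normc.normcM.
Qed.

(** [horner_mx_growth] is applied with [q = 1] and the roots of the characteristic polynomial, which
    annihilates [M]. The bound on eigenvalues is strict because Jordan blocks may add polynomial
    factors. *)
Lemma expmx_upper_bound M r : 0 < r ->
  (forall z, eigenvalue M z -> normc z < r) ->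
  exists2 K, 0 <= K & forall m i j, normc ((M ^+ m) i j) <= K * r ^+ m.
Proof.
move=> r0 Mr.
have entry i j : exists2 K, 0 <= K & forall m, normc ((M ^+ m) i j) <= K * r ^+ m.
  have [s sE] := closed_field_poly_normal (char_poly M).
  rewrite (monicP (char_poly_monic M)) scale1r in sE.
  have sr z : z \in s -> normc z < r.
    move=> zs; apply: Mr.
    by rewrite eigenvalue_root_char sE root_prod_XsubC.
  have [|K K0 MK] := @horner_mx_growth M s 1 i j r r0 sr.
    by rewrite mul1r -sE Cayley_Hamilton.
  exists K => // m; have := MK m.
  by rewrite mul1r rmorphXn /= horner_mx_X.
have [K KP] := choice (fun p : 'I_n.+1 * 'I_n.+1 =>
  let: ex_intro2 K K0 MK := entry p.1 p.2 in ex_intro _ K (conj K0 MK)).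
exists (\sum_p K p); first by apply: sumr_ge0 => p _; case: (KP p).
move=> m i j; have [_ /(_ m)] := KP (i, j); move=> /le_trans; apply.
rewrite ler_wpM2r ?exprn_ge0 ?(ltW r0)// (bigD1 (i, j))//= lerDl.
by apply: sumr_ge0 => p _; case: (KP p).
Qed.

(** A left eigenvector satisfies [v M^m = z^m v]. This is read at a coordinate where [v] does not
    vanish, and each entry of [M^m] is bounded by the sum of the moduli of all entries. *)
Lemma expmx_lower_bound M z : eigenvalue M z ->
  exists2 c, 0 < c & forall m, c * normc z ^+ m <= \sum_i \sum_j normc ((M ^+ m) i j).
Proof.
move=> /eigenvalueP[v vM v0].
have vMm m : v *m M ^+ m = z ^+ m *: v.
  elim: m => [|m IH]; first by rewrite !expr0 mulmx1 scale1r.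
  by rewrite exprSr exprS mulmxA IH -scalemxAl vM scalerA mulrC.
have [j vj0] : exists j, v 0 j != 0.
  apply/existsP; apply: contraNT v0 => /existsPn v0; apply/eqP/rowP => j.
  by rewrite mxE; apply/eqP; rewrite -[_ == _]negbK v0.
have vj_gt0 : 0 < normc (v 0 j).
  rewrite lt_neqAle normc_ge0 andbT eq_sym.
  by apply: contraNneq vj0 => /Normc.eq0_normc ->.
pose S := \sum_i normc (v 0 i).
have S0 : 0 < S.
  by rewrite /S (bigD1 j)//= ltr_wpDr// sumr_ge0// => i _; exact: normc_ge0.
exists (normc (v 0 j) / S); first by rewrite divr_gt0.
move=> m; rewrite mulrAC ler_pdivrMr// mulrC -normcX -Normc.normcM.
have -> : z ^+ m * v 0 j = (z ^+ m *: v) 0 j by rewrite mxE.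
rewrite -vMm mxE (le_trans (ler_normc_sum _ _ _))// mulrC mulr_suml ler_sum//.
move=> i _; rewrite Normc.normcM ler_wpM2l ?normc_ge0//.
rewrite (bigD1 i)//= (bigD1 j)//= -addrA lerDl addr_ge0// sumr_ge0// => l _.
  exact: normc_ge0.
by rewrite sumr_ge0// => p _; exact: normc_ge0.
Qed.

End MatrixGrowth.

(** * Admissible words *)

Section Words.
Context {k : nat} (A : 'M[nat]_k).
Implicit Types (x y : seqk k) (u w : seq 'I_k).

Definition admissible : rel 'I_k := fun i j => A i j == 1%N.

(** The initial letter [i] is left out, so that [m] counts transitions. The recursion then mirrors
    left multiplication by [A], and words of length [m + 1] correspond to the [m]-th matrix
    power. *)
Fixpoint paths (m : nat) (i : 'I_k) : seq (seq 'I_k) :=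
  if m is m'.+1 then
    [seq j :: u | j <- [seq j <- enum 'I_k | admissible i j], u <- paths m' j]
  else [:: [::]].

Definition words (m : nat) : seq (seq 'I_k) :=
  if m is m'.+1 then [seq i :: u | i <- enum 'I_k, u <- paths m' i]
  else [:: [::]].

Lemma mem_paths m i u :
  (u \in paths m i) = (size u == m) && path admissible i u.
Proof.
elim: m i u => [|m IH] i u /=; first by rewrite inE; case: u.
apply/allpairsPdep/idP => [[j [v [+ + ->]]]|].
  by rewrite mem_filter IH => /andP[ij _] /andP[/eqP <- jv]; rewrite /= ij eqxx.
case: u => //= j v /andP[sv /andP[ij jv]]; exists j, v.
by rewrite mem_filter ij mem_enum IH -eqSS sv jv.
Qed.

Lemma mem_words m u : (u \in words m) = (size u == m) && sorted admissible u.
Proof.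
case: m => [|m] /=; first by rewrite inE; case: u.
apply/allpairsPdep/idP => [[j [v [_ + ->]]]|].
  by rewrite mem_paths => /andP[/eqP <- jv] /=; rewrite eqxx.
case: u => //= j v /andP[sv jv]; exists j, v.
by rewrite mem_enum mem_paths -eqSS sv jv.
Qed.

Lemma paths_uniq m i : uniq (paths m i).
Proof.
elim: m i => [//|m IH] i /=; apply: allpairs_uniq_dep => //.
  by rewrite filter_uniq// enum_uniq.
by move=> [a u] [b v] _ _ /= [-> ->].
Qed.

Lemma words_uniq m : uniq (words m).
Proof.
case: m => [//|m] /=; apply: allpairs_uniq_dep; first exact: enum_uniq.
  by move=> i _; exact: paths_uniq.
by move=> [a u] [b v] _ _ /= [-> ->].
Qed.

Lemma agreeP m x y : agree m x y <-> mkseq x m = mkseq y m.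
Proof.
split=> [xy|xy i im]; last by rewrite -(nth_mkseq (x 0%N) x im) xy nth_mkseq.
by apply/eq_in_map => i; rewrite mem_iota add0n => /andP[_ /xy].
Qed.

Lemma mkseq_words m x : SigmaA A x -> mkseq x m \in words m.
Proof.
move=> xA; rewrite mem_words size_mkseq eqxx; apply/(sortedP (x 0%N)) => i.
rewrite size_mkseq => im; rewrite !nth_mkseq ?(ltnW im)//.
by rewrite /admissible xA.
Qed.

Hypothesis k_gt0 : (0 < k)%N.
Hypothesis A_row : forall i, exists j, A i j = 1%N.

(** Every row contains a 1, so the last letter can be continued forever by chosen successors. *)
Lemma words_extend m w : w \in words m ->
  exists x, SigmaA A x /\ mkseq x m = w.
Proof.
have [nxt nxtP] := choice A_row.
have ext u i : path admissible i u ->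
    exists x, SigmaA A x /\ mkseq x (size u).+1 = i :: u.
  elim: u i => [i _|j u IH i /= /andP[ij /IH[x [xA xu]]]].
    by exists (fun n => iter n nxt i); split=> [n|] /=.
  exists (fun n => if n is n'.+1 then x n' else i); split=> [[|n]|] //.
    by move: xu => [-> _]; apply/eqP.
  rewrite -xu /mkseq /=; congr (_ :: _ :: _).
  by rewrite -[2%N]addn1 iotaDl -map_comp; apply: eq_map.
rewrite mem_words => /andP[/eqP <-]; case: w => [_|i u /ext //].
have [x [xA _]] := ext [::] (Ordinal k_gt0) isT.
by exists x.
Qed.

Lemma size_words_gt0 m : (0 < size (words m))%N.
Proof.
have /words_extend[x [xA _]] : [::] \in words 0 by rewrite inE.
by have := mkseq_words m xA; case: (words m).
Qed.

Lemma finite_cover_growth {R : realType} (s : R) (C : seq (seq 'I_k)) : 0 <= s ->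
  (forall w, w \in C -> (0 < size w)%N) ->
  (forall x, SigmaA A x -> exists2 w, w \in C & mkseq x (size w) = w) ->
  \sum_(w <- C) expR (- s * (size w)%:R) <= 1 ->
  exists K, forall N, (size (words N))%:R <= K * expR (s * N%:R).
Proof.
move=> s0 C0 cov sumC; pose L := (\sum_(w <- C) size w)%N.
have sizeC w : w \in C -> (size w <= L)%N.
  by move=> wC; rewrite /L (big_rem w)//= leq_addr.
(* [L] dominates the length of every word of [C]. This constant settles all [N <= L] at once; larger
   [N] are reached by induction. *)
pose K : R := \sum_(N < L.+1) (size (words N))%:R.
have K0 : 0 <= K by rewrite sumr_ge0.
exists K => N; elim/ltn_ind: N => N IH.
have [NL|LN] := leqP N L.
  rewrite (@le_trans _ _ K)//.
    by rewrite /K (bigD1 (Ordinal (NL : (N < L.+1)%N)))//= lerDl sumr_ge0.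
  by rewrite ler_peMr// -expR0 ler_expR mulr_ge0.
(* A word [u] longer than [L] extends to a point [x]. The word of [C] that is a prefix of [x] is
   then a prefix of [u], and what remains of [u] is admissible. *)
have sub : (size (words N) <=
    size [seq w ++ v | w <- C, v <- words (N - size w)])%N.
  apply: uniq_leq_size => [|u uN]; first exact: words_uniq.
  have [x [xA xu]] := words_extend uN; have [w wC xw] := cov x xA.
  have wN : (size w <= N)%N by rewrite ltnW// (leq_ltn_trans (sizeC w wC)).
  apply/allpairsPdep; exists w, (drop (size w) u); split=> //.
    move: uN; rewrite !mem_words size_drop => /andP[/eqP -> su].
    by rewrite eqxx drop_sorted.
  rewrite -[LHS](cat_take_drop (size w)) -{1}xu -map_take take_iota.
  by rewrite (minn_idPl wN) -/(mkseq _ _) xw.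
rewrite -(ler_nat R) in sub; rewrite (le_trans sub)//.
rewrite size_allpairs_dep sumnE big_map natr_sum.
(* By induction the term of [w] is at most [K exp(s (N - |w|))]; factoring out [K exp(s N)] leaves
   the cost of [C], which is at most 1. *)
apply: (@le_trans _ _ (K * expR (s * N%:R) * \sum_(w <- C) expR (- s * (size w)%:R))).
  rewrite mulr_sumr big_seq [leRHS]big_seq ler_sum// => w wC.
  have wN : (size w <= N)%N by rewrite ltnW// (leq_ltn_trans (sizeC w wC)).
  rewrite -mulrA -expRD mulNr -mulrBr -natrB// IH//.
  by rewrite ltn_subrL (C0 w wC) (leq_ltn_trans _ LN).
by rewrite ler_piMr// mulr_ge0// expR_ge0.
Qed.

(* König's lemma on the tree of prefixes without a finite subcover. *)
Lemma cylinder_cover_finite (D : set nat) (c : nat -> seqk k) (m : nat -> nat) :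
  (forall x, SigmaA A x -> exists2 i, D i & agree (m i) (c i) x) ->
  exists2 F : seq nat, (forall i, i \in F -> D i) &
    forall x, SigmaA A x -> exists2 i, i \in F & agree (m i) (c i) x.
Proof.
move=> cov.
pose fin u := exists2 F : seq nat, (forall i, i \in F -> D i) &
  forall x, SigmaA A x -> mkseq x (size u) = u ->
    exists2 i, i \in F & agree (m i) (c i) x.
suff [F FD Fcov] : fin [::] by exists F => // x xA; exact: Fcov.
apply: contrapT => nfin0.
(* If all one-letter extensions had finite subcovers, their union would be one for [u]. The
   implication stands under the quantifier so that a letter can be chosen for every [u]. *)
have step u : exists a, ~ fin u -> ~ fin (rcons u a).
  apply: contrapT => /forallNP H.
  have {}H a : ~ fin u /\ fin (rcons u a).
    by have /not_implyP[? /contrapT] := H a.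
  have [nfu _] := H (Ordinal k_gt0); apply: nfu.
  have [F FP] := choice (fun a => let: conj _ (ex_intro2 F FD Fcov) := H a in
    ex_intro (fun F => _ /\ _) F (conj FD Fcov)).
  exists (flatten [seq F a | a <- enum 'I_k]).
    by move=> i /flatten_mapP[a _]; have [FD _] := FP a; exact: FD.
  move=> x xA xu; have [_ Fcov] := FP (x (size u)).
  have [||i iF ix] := Fcov x _ _ => //.
    by rewrite size_rcons mkseqS xu.
  by exists i => //; apply/flatten_mapP; exists (x (size u)); rewrite ?mem_enum.
have [nxt nxtP] := choice step.
pose p n := iter n (fun u => rcons u (nxt u)) [::].
pose x : seqk k := fun n => nxt (p n).
have px n : p n = mkseq x n by elim: n => //= n IH; rewrite mkseqS -IH.
have nfin n : ~ fin (mkseq x n).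
  by rewrite -px; elim: n => //= n /nxtP.
(* A cylinder without admissible points is covered by the empty family, so every prefix of [x] is
   shared with an admissible point. Admissibility of [x] follows. *)
have near n : exists2 z, SigmaA A z & agree n z x.
  apply: contrapT => H; apply: (nfin n); exists [::] => // z zA.
  by rewrite size_mkseq => /agreeP zx; case: H; exists z.
have xA : SigmaA A x.
  move=> n; have [z zA zx] := near n.+2.
  by rewrite -!zx//; exact: zA.
have [i Di ix] := cov x xA.
apply: (nfin (m i)); exists [:: i]; first by move=> j; rewrite inE => /eqP ->.
move=> y yA; rewrite size_mkseq => /agreeP yx; exists i; first exact: mem_head.
exact: agree_trans ix (agree_sym yx).
Qed.

End Words.

(** * Spectral radius and the number of admissible words *)

Section WordGrowth.
Context {R : realType} {k : nat} (A : 'M[nat]_k.+1).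
Hypothesis A01 : forall i j, A i j = 0%N \/ A i j = 1%N.
Hypothesis A_row : forall i, exists j, A i j = 1%N.
Local Notation normc := (@Normc.normc R).
Let M : 'M[R[i]]_k.+1 := map_mx (fun a : nat => (a%:R : R[i])) A.
Local Notation rho := (@spectral_radius R k.+1 A).

Lemma size_paths m i : (size (paths A m i))%:R = \sum_j (M ^+ m) i j.
Proof.
elim: m i => [|m IH] i.
  rewrite expr0 (bigD1 i)//= big1 => [|j ji]; rewrite !mxE ?eqxx ?addr0//.
  by rewrite eq_sym (negbTE ji).
rewrite /= size_allpairs_dep sumnE big_map big_filter big_enum_cond natr_sum.
rewrite exprS; under [RHS]eq_bigr do rewrite mxE.
rewrite exchange_big /= big_mkcond /=; apply: eq_bigr => j _.
rewrite -mulr_sumr -IH mxE /admissible.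
by have [->|->] := A01 i j; rewrite ?mul0r ?mul1r.
Qed.

Lemma spectrum_nonempty : exists z, eigenvalue M z.
Proof.
have : size (char_poly M) != 1%N by rewrite size_char_poly.
by move=> /closed_rootP[z]; rewrite -eigenvalue_root_char; exists z.
Qed.

(** [sup] is an upper bound only for bounded sets; the sum of the moduli of all roots of the
    characteristic polynomial bounds the spectrum. *)
Lemma ler_spectral_radius z : eigenvalue M z -> normc z <= rho.
Proof.
move=> zM; apply: ub_le_sup; last by exists z.
have [s sE] := closed_field_poly_normal (char_poly M).
rewrite (monicP (char_poly_monic M)) scale1r in sE.
exists (\sum_(w <- s) normc w) => _ [w /= + <-].
rewrite eigenvalue_root_char sE root_prod_XsubC => ws.
rewrite (big_rem w)//= lerDl sumr_ge0// => u _; exact: normc_ge0.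
Qed.

Lemma spectral_radius_le r :
  (forall z, eigenvalue M z -> normc z <= r) -> rho <= r.
Proof.
move=> H; apply: ge_sup; last by move=> _ [z zM <-]; exact: H.
by have [z zM] := spectrum_nonempty; exists (normc z), z.
Qed.

Lemma words_upper_bound r : 0 < r -> rho < r ->
  exists2 K, 0 < K & forall m, (size (words A m))%:R <= K * r ^+ m.
Proof.
move=> r0 rho_r.
have [z zM|K K0 MK] := @expmx_upper_bound R k M r r0.
  exact: le_lt_trans (ler_spectral_radius zM) rho_r.
pose K' := \sum_(i < k.+1) \sum_(j < k.+1) K.
have K'0 : 0 <= K' by rewrite sumr_ge0// => i _; rewrite sumr_ge0.
(* The 1 accounts for the empty word; the division by [r] compensates for words of length [m + 1]
   being counted by the power [m]. *)
exists (1 + K' / r); first by rewrite ltr_pwDl// divr_ge0// ltW.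
case=> [|m]; first by rewrite expr0 mulr1 lerDl divr_ge0// ltW.
have rm : 0 <= r ^+ m.+1 by rewrite exprn_ge0// ltW.
apply: (@le_trans _ _ (K' / r * r ^+ m.+1)); last by rewrite ler_wpM2r// lerDr.
rewrite exprS mulrA divfK ?gt_eqF// /= size_allpairs_dep sumnE big_map big_enum.
rewrite natr_sum mulr_suml ler_sum// => i _.
rewrite -normc_nat size_paths (le_trans (ler_normc_sum _ _ _))//.
by rewrite mulr_suml ler_sum.
Qed.

Lemma words_lower_bound z : eigenvalue M z ->
  exists2 c, 0 < c & forall m, c * normc z ^+ m <= (size (words A m.+1))%:R.
Proof.
move=> /expmx_lower_bound[c c0 cP]; exists c => // m; rewrite (le_trans (cP m))//.
rewrite /= size_allpairs_dep sumnE big_map big_enum natr_sum ler_sum// => i _.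
(* The entries are nonnegative, so the moduli in the eigenvector bound are the entries that count
   words. *)
have Mpos j : (M ^+ m) i j = `|(M ^+ m) i j|.
  suff : 0 <= (M ^+ m) i j by move=> /ger0_norm.
  elim: m i j {cP} => [|m IH] i j; first by rewrite expr0 mxE ler0n.
  by rewrite exprS mxE sumr_ge0// => l _; rewrite mulr_ge0// mxE ler0n.
rewrite -(@lecR R) rmorph_nat size_paths rmorph_sum /= ler_sum// => j _.
by rewrite [leRHS]Mpos.
Qed.
End WordGrowth.

(** * Hausdorff measures and Bowen sums *)

Section NatSums.
Context {R : realType}.
Implicit Types (D : set nat) (a : nat -> R).

Lemma esum_seriesE D (a : nat -> \bar R) : (forall i, 0 <= a i)%E ->
  \esum_(i in D) a i = (\sum_(0 <= i <oo | i \in D) a i)%E.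
Proof. by move=> a0; rewrite nneseries_esum// set_mem_set. Qed.

Lemma esumZl D (C : R) a : 0 <= C -> (forall i, 0 <= a i) ->
  (\esum_(i in D) (C * a i)%:E = C%:E * \esum_(i in D) (a i)%:E)%E.
Proof.
move=> C0 a0; rewrite (esum_seriesE _ (a := fun i => (a i)%:E))//.
rewrite esum_seriesE => [|i]; last by rewrite lee_fin mulr_ge0.
by rewrite -nneseriesZl// => i _; rewrite lee_fin.
Qed.

Lemma esum_add_eps D a (e : R) : 0 <= e -> (forall i, 0 <= a i) ->
  (\esum_(i in D) (a i + e / (2 ^ i.+1)%:R)%:E <= \esum_(i in D) (a i)%:E + e%:E)%E.
Proof.
move=> e0 a0; rewrite (esum_seriesE _ (a := fun i => (a i)%:E))//.
rewrite esum_seriesE => [|i]; last by rewrite lee_fin addr_ge0// divr_ge0.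
under eq_eseriesr do rewrite EFinD.
by apply: epsilon_trick => // i; rewrite lee_fin.
Qed.

End NatSums.

(** The right limit of such a function is its supremum over positive arguments. This turns a
    vanishing Hausdorff measure into a condition at every scale, free of limits. *)
Lemma nonincreasing_lim_right_eq0 {R : realType} (f : R -> \bar R) :
  (forall x, (0 <= f x)%E) ->
  (forall x y, 0 < x -> x <= y -> (f y <= f x)%E) ->
  lim (f x @[x --> 0^'+]) = 0%E <-> (forall x, 0 < x -> f x = 0%E).
Proof.
move=> f0 fdec.
have fcvg : f x @[x --> 0^'+] --> ereal_sup [set f x | x in `]0, +oo[%classic].
  apply: nonincreasing_at_right_cvge => // x y; rewrite !in_itv/= !andbT.
  by move=> x0 _ xy; exact: fdec.
rewrite (cvg_lim _ fcvg)//; split=> [sup0 x x0|f_eq0].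
  apply/eqP; rewrite eq_le f0 andbT -sup0; apply: ereal_sup_ubound.
  by exists x => //; rewrite /= in_itv/= x0.
apply/eqP; rewrite eq_le; apply/andP; split.
  by apply: ge_ereal_sup => _ [x + <-]; rewrite /= in_itv/= andbT => /f_eq0 ->.
rewrite -(f_eq0 1)//; apply: ereal_sup_ubound; exists 1 => //.
by rewrite /= in_itv/= ltr01.
Qed.

Lemma nondecreasing_lim_eq0 {R : realType} (u : nat -> \bar R) :
  (forall n, (0 <= u n)%E) -> {homo u : n m / (n <= m)%N >-> (n <= m)%E} ->
  lim (u n @[n --> \oo]) = 0%E <-> (forall n, u n = 0%E).
Proof.
move=> u0 uinc; rewrite (cvg_lim _ (ereal_nondecreasing_cvgn uinc))//.
split=> [sup0 n|u_eq0].
  by apply/eqP; rewrite eq_le u0 andbT -sup0; apply: ereal_sup_ubound; exists n.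
apply/eqP; rewrite eq_le; apply/andP; split.
  by apply: ge_ereal_sup => _ [n _ <-]; rewrite u_eq0.
by rewrite -(u_eq0 0%N); apply: ereal_sup_ubound; exists 0%N.
Qed.

Lemma ereal_le0_eps {R : realType} (x : \bar R) : (0 <= x)%E ->
  (forall e : R, 0 < e -> (x <= e%:E)%E) -> x = 0%E.
Proof.
move=> x0 xe; apply/eqP; rewrite eq_le x0 andbT.
by apply/lee_addgt0Pr => e /xe; rewrite add0e.
Qed.

Section Covers.
Context {R : realType} {T : choiceType} (X : set T) (d : T -> T -> R) (f : T -> T).

Lemma hausdorff_content_ge0 s delta E :
  (0 <= hausdorff_content X d s delta E)%E.
Proof.
apply: le_ereal_inf_tmp => _ [D [U [_ [_ ->]]]]; apply: esum_ge0 => i _.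
by rewrite lee_fin powR_ge0.
Qed.

Lemma bowen_M_n_ge0 alpha K s eps n :
  (0 <= bowen_M_n X d f alpha K s eps n)%E.
Proof.
apply: le_ereal_inf_tmp => _ [D [c [m [_ [_ ->]]]]]; apply: esum_ge0 => i _.
by rewrite lee_fin expR_ge0.
Qed.

Lemma hausdorff_measure_eq0 s E : hausdorff_measure X d s E = 0%E <->
  forall delta, 0 < delta -> hausdorff_content X d s delta E = 0%E.
Proof.
apply: nonincreasing_lim_right_eq0 => [x|x y x0 xy].
  exact: hausdorff_content_ge0.
apply: ereal_inf_le_tmp => _ [D [U [UX [EU ->]]]]; exists D, U; split=> //.
by move=> i /UX[UiX Ux]; split=> //; exact: le_trans xy.
Qed.

Lemma bowen_M_eq0 alpha K s eps : bowen_M X d f alpha K s eps = 0%E <->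
  forall n, bowen_M_n X d f alpha K s eps n = 0%E.
Proof.
apply: nondecreasing_lim_eq0 => [n|n m nm].
  exact: bowen_M_n_ge0.
apply: ereal_inf_le_tmp => _ [D [c [l [cX [Kc ->]]]]]; exists D, c, l; split=> //.
by move=> i /cX[ciX ml]; split=> //; exact: leq_trans ml.
Qed.

Lemma hausdorff_content_lt s delta E e : (hausdorff_content X d s delta E < e)%E ->
  exists (D : set nat) (U : nat -> set T),
    [/\ forall i, D i -> U i `<=` X /\ diam d (U i) <= delta,
        E `<=` \bigcup_(i in D) U i &
        (\esum_(i in D) (diam d (U i) `^ s)%:E < e)%E].
Proof. by move=> /ereal_inf_lt[_ [D [U [UX [EU ->]]]] ltD]; exists D, U. Qed.

Lemma bowen_M_n_lt alpha K s eps n e : (bowen_M_n X d f alpha K s eps n < e)%E ->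
  exists (D : set nat) (c : nat -> T) (m : nat -> nat),
    [/\ forall i, D i -> X (c i) /\ (n <= m i)%N,
        K `<=` \bigcup_(i in D) bowen_ball X d f alpha (m i) (c i) eps &
        (\esum_(i in D) (expR (- s * (m i)%:R))%:E < e)%E].
Proof.
by move=> /ereal_inf_lt[_ [D [c [m [cX [Kc ->]]]]] ltD]; exists D, c, m.
Qed.

End Covers.

Section Diameter.
Context {R : realType} {k : nat}.
Implicit Types (U : set (seqk k)).
Local Notation dist := (@shift_dist R k).

Lemma shift_dist_le1 x y : dist x y <= 1.
Proof. by rewrite -expR0 -oppr0 (shift_dist_leP 0). Qed.

Lemma diam_le U r : 0 <= r ->
  (forall x y, U x -> U y -> dist x y <= r) -> diam dist U <= r.
Proof.
move=> r0 Ur; rewrite /diam.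
have [->|/set0P H] := eqVneq [set dist p.1 p.2 | p in U `*` U] set0.
  by rewrite sup0.
by apply: ge_sup => // _ [[x y] [/= Ux Uy] <-]; exact: Ur.
Qed.

Lemma le_diam U x y : U x -> U y -> dist x y <= diam dist U.
Proof.
move=> Ux Uy; apply: ub_le_sup; last by exists (x, y).
by exists 1 => _ [[a b] _ <-]; exact: shift_dist_le1.
Qed.

Lemma diam_ge0 U : 0 <= diam dist U.
Proof.
have [->|/set0P[x Ux]] := eqVneq U set0.
  rewrite /diam (_ : [set _ | _ in _] = set0) ?sup0//.
  by apply/seteqP; split=> // _ [[x y] [[]]].
exact: le_trans (shift_dist_ge0 x x) (le_diam Ux Ux).
Qed.

End Diameter.

(** * Comparison of Hausdorff dimension and Bowen entropy *)

Section DimensionEntropy.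
Context {R : realType} {k : nat} (X : set (seqk k)).
Local Notation dist := (@shift_dist R k).
Variables (alpha eps : R).
Hypotheses (alpha0 : 0 <= alpha) (eps01 : 0 < eps <= 1).

Lemma diam_bowen_ball n x : (0 < n)%N ->
  diam dist (bowen_ball X dist sigma_shift alpha n x eps) <=
  expR (- (ball_depth alpha eps n)%:R).
Proof.
move=> n0; apply: diam_le => [|y z [_ xy] [_ xz]]; first exact: expR_ge0.
apply/shift_dist_leP; apply: (@agree_trans _ _ _ x).
  by apply: agree_sym; exact/dist_n_alpha_ltP.
exact/dist_n_alpha_ltP.
Qed.

(** The Bowen balls themselves serve as covering sets. The diameter of a ball of time [m], raised to
    the power [s / (1 + alpha)], is at most [exp(- s (m - 1))], so only the constant factor [exp s]
    is lost. *)
Lemma hausdorff_measure_eq0_of_bowen E s : 0 <= s ->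
  bowen_M X dist sigma_shift alpha E s eps = 0%E ->
  hausdorff_measure X dist (s / (1 + alpha)) E = 0%E.
Proof.
move=> s0 /bowen_M_eq0 M0; apply/hausdorff_measure_eq0 => delta delta0.
apply: ereal_le0_eps => [|e e0]; first exact: hausdorff_content_ge0.
have a1 : 0 < 1 + alpha by rewrite ltr_pwDl.
set t := s / (1 + alpha).
have t0 : 0 <= t by rewrite divr_ge0// ltW.
have [eps0 eps1] := andP eps01.
(* Now [exp(- n) <= delta]; since the depth of a ball is at least its time, all balls used have
   diameter at most [delta]. *)
pose n := (Num.truncn (- ln delta)).+1.
have [|D [c [m [cX Ec sumD]]]] := @bowen_M_n_lt _ _ X dist sigma_shift alpha E s
    eps n (e / expR s)%:E.
  by rewrite M0 lte_fin divr_gt0// expR_gt0.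
apply: (@le_trans _ _ (\esum_(i in D) (expR s * expR (- s * (m i)%:R))%:E)%E); last first.
  rewrite esumZl ?expR_ge0//.
  by rewrite muleC -lee_pdivlMr ?expR_gt0// -EFinM ltW.
apply: le_trans; first apply: ereal_inf_lbound.
  exists D, (fun i => bowen_ball X dist sigma_shift alpha (m i) (c i) eps).
  split; last by split; [exact: Ec|reflexivity].
  move=> i Di; have [ciX nm] := cX i Di; split; first by move=> y [].
  have m0 : (0 < m i)%N by exact: leq_trans nm.
  apply: (le_trans (diam_bowen_ball _ m0)).
  rewrite -[leRHS]lnK ?posrE// ler_expR lerNl.
  apply: (@le_trans _ _ n%:R); first by rewrite ltW// truncnS_gt.
  by rewrite ler_nat (leq_trans nm)// ball_depth_geq.
apply: le_esum => i Di; have [ciX nm] := cX i Di.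
have m0 : (0 < m i)%N by exact: leq_trans nm.
rewrite lee_fin; apply: (@le_trans _ _ (expR (- (ball_depth alpha eps (m i))%:R) `^ t)).
  by rewrite ge0_ler_powR// ?nnegrE ?diam_ge0 ?expR_ge0// diam_bowen_ball.
rewrite -expRM -expRD ler_expR.
have /ltW/(ler_wpM2l t0) := ball_depth_gt alpha eps (m i).
have -> : t * ((1 + alpha) * (m i).-1%:R - ln eps) =
    t * (1 + alpha) * ((m i)%:R - 1) - t * ln eps.
  by rewrite -subn1 natrB//; ring.
have : t * ln eps <= 0 by rewrite mulr_ge0_le0// ln_le0.
rewrite divfK ?gt_eqF//; set p : R := (m i)%:R; set q : R := _%:R; lra.
Qed.

(** An inverse of [ball_depth] up to a bounded error, obtained by solving [(1 + alpha)(m - 1) - ln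
    eps + 1 <= - ln r] for [m]. For small [r], a Bowen ball of this time contains all points of the
    space within [r] of its centre. *)
Definition cover_time (r : R) : nat :=
  (Num.truncn ((- ln r - 1 + ln eps) / (1 + alpha))).+1.

Lemma cover_time_ge r n :
  ln r <= - ((1 + alpha) * n%:R + 1 - ln eps) -> (n <= cover_time r)%N.
Proof.
move=> H; have a1 : 0 < 1 + alpha by rewrite ltr_pwDl.
rewrite /cover_time ltnW// ltnS.
have nQ : n%:R <= (- ln r - 1 + ln eps) / (1 + alpha).
  by rewrite ler_pdivlMr//; lra.
by rewrite truncn_ge_nat// (le_trans _ nQ).
Qed.

(** The hypothesis makes the truncated quotient nonnegative; a negative one would be truncated to 0,
    hence rounded up. *)
Lemma ball_depth_cover_time r : ln r <= - (1 - ln eps) ->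
  (ball_depth alpha eps (cover_time r))%:R <= - ln r.
Proof.
move=> H; have a1 : 0 < 1 + alpha by rewrite ltr_pwDl.
apply: (le_trans (ball_depth_le _ alpha0 eps01)); rewrite /cover_time /=.
set Q := (- ln r - 1 + ln eps) / (1 + alpha).
have Q0 : 0 <= Q by rewrite divr_ge0 ?(ltW a1)//; lra.
have : (1 + alpha) * (Num.truncn Q)%:R <= (1 + alpha) * Q.
  by rewrite ler_wpM2l ?truncn_le// ltW.
by rewrite {2}/Q [in X in _ <= X]mulrC divfK ?gt_eqF//; lra.
Qed.

Lemma expR_cover_time r t : 0 < r -> 0 <= t ->
  expR (- ((1 + alpha) * t) * (cover_time r)%:R) <= expR (t * (1 - ln eps)) * r `^ t.
Proof.
move=> r0 t0; have a1 : 0 < 1 + alpha by rewrite ltr_pwDl.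
rewrite /powR gt_eqF// -expRD ler_expR.
have := truncnS_gt ((- ln r - 1 + ln eps) / (1 + alpha)).
rewrite -/(cover_time r) => /ltW; rewrite ler_pdivrMr// => /(ler_wpM2l t0).
lra.
Qed.

(** Each covering set is placed in the Bowen ball around one of its points whose time matches the
    diameter. From [t < t'] comes [0 < t'], so a set of diameter zero fits in a ball of arbitrarily
    small cost. *)
Lemma bowen_eq0_of_hausdorff_measure E t t' : X !=set0 -> E `<=` X -> 0 <= t -> t < t' ->
  hausdorff_measure X dist t E = 0%E ->
  bowen_M X dist sigma_shift alpha E ((1 + alpha) * t') eps = 0%E.
Proof.
move=> [x0 Xx0] EX t0 tt' /hausdorff_measure_eq0 H0; apply/bowen_M_eq0 => n.
have t'0 : 0 < t' by exact: le_lt_trans tt'.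
have a1 : 0 < 1 + alpha by rewrite ltr_pwDl.
have [eps0 eps1] := andP eps01; have leps := ln_le0 eps1.
apply: ereal_le0_eps => [|e e0]; first exact: bowen_M_n_ge0.
(* For radii at most [exp(- B)], the covering time is at least [n] and [ball_depth_cover_time]
   applies. *)
set B := (1 + alpha) * n%:R + 1 - ln eps.
have B0 : 0 <= B by rewrite /B addr_ge0 ?oppr_ge0// addr_ge0// mulr_ge0// ltW.
set C := expR (t' * (1 - ln eps)); have C0 : 0 < C by exact: expR_gt0.
(* Dividing by [C] offsets the factor in [expR_cover_time]. One half pays for the diameters, the
   other for the correction at sets of diameter zero. *)
have [|D [U [UX EU sumD]]] := @hausdorff_content_lt _ _ X dist t (expR (- B)) E
    (e / C / 2)%:E.
  by rewrite H0 ?expR_gt0// lte_fin !divr_gt0.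
pose e' := e / C / 2; have e'0 : 0 < e' by rewrite !divr_gt0.
(* A set of diameter zero contains no scale to read a covering time from, so
   it is given a positive radius whose cost is summable. *)
pose r i := if 0 < diam dist (U i) then diam dist (U i)
            else Num.min (expR (- B)) ((e' / (2 ^ i.+1)%:R) `^ (t')^-1).
have e'i i : 0 < e' / (2 ^ i.+1)%:R by rewrite divr_gt0// ltr0n expn_gt0.
have r0 i : 0 < r i.
  by rewrite /r; case: ifP => // _; rewrite lt_min expR_gt0 powR_gt0.
have Ur i : diam dist (U i) <= r i.
  rewrite /r; case: ltP => // h; apply: (le_trans h); apply/ltW.
  by rewrite lt_min expR_gt0 powR_gt0.
have rB i : D i -> r i <= expR (- B).
  by move=> /UX[_ h]; rewrite /r; case: ifP => // _; rewrite ge_min lexx.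
have lr i : D i -> ln (r i) <= - B.
  by move=> /rB; rewrite -[X in X <= _ -> _]lnK ?posrE// ler_expR.
(* A positive diameter is at most 1, so the larger exponent gives the smaller power; otherwise the
   second term alone suffices by the choice of [r i]. *)
have rt i : D i -> r i `^ t' <= diam dist (U i) `^ t + e' / (2 ^ i.+1)%:R.
  move=> Di; rewrite /r; case: ifP => [h|_].
    apply: ler_wpDr; first exact: ltW.
    rewrite ger_powR ?(ltW tt')// h/= (le_trans (proj2 (UX i Di)))//.
    by rewrite -expR0 ler_expR oppr_le0.
  apply: ler_wpDl; first exact: powR_ge0.
  apply: (@le_trans _ _ (((e' / (2 ^ i.+1)%:R) `^ (t')^-1) `^ t')).
    rewrite ge0_ler_powR ?(ltW t'0)// ?nnegrE ?powR_ge0 ?ge_min ?lexx ?orbT//.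
    by apply/ltW; rewrite lt_min expR_gt0 powR_gt0.
  by rewrite -powRrM mulVf ?gt_eqF// powRr1// ltW.
(* The family may contain empty sets, but centres must lie in [X]; [x0] is the default. *)
pose c i := if pselect (exists x, U i x) is left H then projT1 (cid H) else x0.
have cX i : D i -> X (c i).
  rewrite /c => Di; case: pselect => [H|_] //.
  by case: cid => x /= Ux; exact: (proj1 (UX i Di)).
have cU i x : U i x -> U i (c i).
  by rewrite /c => Ux; case: pselect => [H|[]]; [case: cid|exists x].
apply: (@le_trans _ _ (\esum_(i in D) (C * (diam dist (U i) `^ t + e' / (2 ^ i.+1)%:R))%:E)%E).
  apply: le_trans; first apply: ereal_inf_lbound.
    exists D, c, (fun i => cover_time (r i)); split.
      move=> i Di; split; first exact: cX.
      by apply: cover_time_ge; exact: lr.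
    split; last reflexivity.
    move=> x Ex; have [i Di Ux] := EU x Ex; exists i => //; split; first exact: EX.
    apply/dist_n_alpha_ltP => //; apply/(@shift_dist_leP R).
    rewrite (le_trans (le_diam (cU i x Ux) Ux))// (le_trans (Ur i))//.
    rewrite -[leLHS]lnK ?posrE// ler_expR lerNr ball_depth_cover_time//.
    rewrite (le_trans (lr i Di))// lerN2 /B.
    have : 0 <= (1 + alpha) * n%:R by rewrite mulr_ge0// ltW.
    lra.
  apply: le_esum => i Di; rewrite lee_fin.
  apply: (le_trans (expR_cover_time (r0 i) (ltW t'0))).
  by rewrite ler_wpM2l ?(ltW C0)// rt.
rewrite esumZl ?(ltW C0)// => [|i]; last by rewrite addr_ge0 ?powR_ge0 ?ltW.
rewrite muleC -lee_pdivlMr// -EFinM.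
apply: (le_trans (esum_add_eps _ (ltW e'0) _)) => [i|]; first exact: powR_ge0.
have -> : e * C^-1 = e' + e' by rewrite /e'; field; rewrite gt_eqF.
by rewrite EFinD leeD2r// ltW.
Qed.

(** The two infima are compared at a fixed [eps]. Passing from arbitrary covers to Bowen balls
    requires [t < t'], hence a slack [e] that vanishes in the infimum. *)
Lemma bowen_crit_hausdorff_dim E : X !=set0 -> E `<=` X ->
  bowen_crit X dist sigma_shift alpha E eps =
  ((1 + alpha)%:E * hausdorff_dim X dist E)%E.
Proof.
move=> X0 EX; have a1 : 0 < 1 + alpha by rewrite ltr_pwDl.
apply/eqP; rewrite eq_le; apply/andP; split.
  rewrite -lee_pdivrMl//; apply: le_ereal_inf_tmp => _ [t [t0 Ht] <-].
  rewrite lee_pdivrMl// -EFinM; apply/lee_addgt0Pr => e e0.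
  apply: ereal_inf_lbound; exists ((1 + alpha) * t + e) => //; split.
    by rewrite addr_ge0 ?(ltW e0)// mulr_ge0// ltW.
  have -> : (1 + alpha) * t + e = (1 + alpha) * (t + e / (1 + alpha)).
    by field; rewrite gt_eqF.
  apply: (bowen_eq0_of_hausdorff_measure X0 EX t0 _ Ht).
  by rewrite ltrDl divr_gt0.
apply: le_ereal_inf_tmp => _ [s [s0 Hs] <-]; rewrite -lee_pdivlMl// -EFinM.
apply: ereal_inf_lbound; exists ((1 + alpha)^-1 * s) => //; split.
  by rewrite mulr_ge0// invr_ge0 ltW.
by rewrite mulrC; exact: hausdorff_measure_eq0_of_bowen.
Qed.

End DimensionEntropy.

(** [bowen_crit] has the same value for all [0 < eps <= 1], so the limit is that of an eventually
    constant function. *)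
Lemma bowen_entropy_hausdorff_dim {R : realType} {k : nat} (X E : set (seqk k))
    (alpha : R) : 0 <= alpha -> X !=set0 -> E `<=` X ->
  bowen_entropy X (@shift_dist R k) sigma_shift alpha E =
  ((1 + alpha)%:E * hausdorff_dim X (@shift_dist R k) E)%E.
Proof.
move=> a0 X0 EX; apply: lim_near_cst; first exact: ereal_hausdorff.
near=> eps; apply: bowen_crit_hausdorff_dim => //.
by apply/andP; split; near: eps; [exact: nbhs_right_gt|exact: nbhs_right_le].
Unshelve. all: by end_near.
Qed.

(** * Dimension and entropy of the subshift *)

(** If [y < x], Bernoulli's inequality makes [(x / y)^m] grow at least linearly, against the bound
    [K / c]. *)
Lemma ler_of_geometric {R : realType} (x y c K : R) : 0 < c -> 0 < y ->
  (forall m, c * x ^+ m <= K * y ^+ m) -> x <= y.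
Proof.
move=> c0 y0 H; rewrite leNgt; apply/negP => yx.
have h0 : 0 < x / y - 1 by rewrite subr_gt0 ltr_pdivlMr// mul1r.
have bern m : 1 + m%:R * (x / y - 1) <= (x / y) ^+ m.
  elim: m => [|m IH]; first by rewrite mul0r addr0 expr0.
  rewrite exprS -natr1; have : 0 <= m%:R * (x / y - 1) by rewrite mulr_ge0// ltW.
  move: IH h0; set q := x / y; set p := q ^+ m; set v : R := m%:R.
  move=> IH h0 vq; have : q * (1 + v * (q - 1)) <= q * p.
    by rewrite ler_wpM2l//; lra.
  have : 0 <= (q - 1) * (v * (q - 1)) by rewrite mulr_ge0// ltW.
  lra.
have cK m : c * (1 + m%:R * (x / y - 1)) <= K.
  apply: (@le_trans _ _ (c * (x / y) ^+ m)); first by rewrite ler_wpM2l// ltW.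
  by rewrite expr_div_n mulrA ler_pdivrMr ?exprn_gt0.
have := cK (Num.truncn (K / (c * (x / y - 1)))).+1.
have := truncnS_gt (K / (c * (x / y - 1))).
rewrite ltr_pdivrMr ?mulr_gt0//; set v : R := _.+1%:R; set h := x / y - 1.
lra.
Qed.

Section SubshiftDimension.
Context {R : realType} {k : nat} (A : 'M[nat]_k.+1).
Hypothesis A01 : forall i j, A i j = 0%N \/ A i j = 1%N.
Hypothesis A_row : forall i, exists j, A i j = 1%N.
Local Notation X := (SigmaA A).
Local Notation dist := (@shift_dist R k.+1).
Local Notation rho := (@spectral_radius R k.+1 A).
Local Notation W m := (size (words A m)).

Lemma words_choice m : exists ext : seq 'I_k.+1 -> seqk k.+1,
  forall w, w \in words A m -> X (ext w) /\ mkseq (ext w) m = w.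
Proof.
have H w : exists x, w \in words A m -> X x /\ mkseq x m = w.
  have [wm|_] := boolP (w \in words A m); last by exists (fun=> ord0).
  by have [x xP] := words_extend (ltn0Sn k) A_row wm; exists x.
by have [ext extP] := choice H; exists ext.
Qed.

Lemma SigmaA_nonempty : X !=set0.
Proof.
have [ext extP] := words_choice 0.
by exists (ext [::]); have [] := extP [::]; rewrite ?inE.
Qed.

Lemma natr_words_ge1 m : 1 <= (W m)%:R :> R.
Proof. by rewrite (ler_nat R 1) size_words_gt0. Qed.

(** There is an admissible word of every length, whereas [rho < 1] would make their number decay
    geometrically. Hence [0 <= ln rho], as the infima over nonnegative exponents require. *)
Lemma spectral_radius_ge1 : 1 <= rho.
Proof.
rewrite leNgt; apply/negP => rho1.
have rho0 : 0 <= rho.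
  have [z zM] := @spectrum_nonempty R _ A.
  exact: le_trans (normc_ge0 z) (ler_spectral_radius zM).
have r0 : 0 < (rho + 1) / 2 by lra.
have [K _ KP] := words_upper_bound A01 r0 (ltac:(lra)).
suff : 1 <= (rho + 1) / 2 by lra.
apply: (@ler_of_geometric _ _ _ 1 K) => // m.
by rewrite expr1n mul1r (le_trans _ (KP m))// natr_words_ge1.
Qed.

Lemma spectral_radius_gt0 : 0 < rho.
Proof. exact: lt_le_trans ltr01 spectral_radius_ge1. Qed.

(** At [alpha = 0] and [eps = 1] a Bowen ball is exactly a cylinder of length [n]; the dimension is
    computed at this scale. *)
Lemma ball_depth_unit n : (0 < n)%N -> ball_depth (0 : R) 1 n = n.
Proof.
by move=> n0; rewrite /ball_depth addr0 mul1r ln1 subr0 natrK prednK.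
Qed.

Lemma ltr01_ler11 : (0 : R) < 1 <= (1 : R).
Proof. by rewrite ltr01 lexx. Qed.

Lemma ln_spectral_radius_le s : 0 <= s ->
  bowen_M X dist sigma_shift 0 X s 1 = 0%E -> ln rho <= s.
Proof.
move=> s0 /bowen_M_eq0 M0.
(* Minimal time 1 and cost below 1 supply what [finite_cover_growth] asks for: nonempty words of
   total cost at most 1. *)
have [|D [c [m [cX Xc sumD]]]] := @bowen_M_n_lt _ _ X dist sigma_shift 0 X s 1 1 1%:E.
  by rewrite M0 lte_fin.
have [|F FD FX] := @cylinder_cover_finite _ A (ltn0Sn k) D c m.
  move=> x /Xc[i Di [_ ci]]; exists i => //.
  have mi := proj2 (cX i Di); rewrite -(ball_depth_unit mi).
  by apply/(@dist_n_alpha_ltP R) => //; exact: ltr01_ler11.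
(* Repeated indices are removed so that the finite sum is a partial sum of the one over [D]. *)
pose C := [seq mkseq (c i) (m i) | i <- undup F].
have [|||K KP] := @finite_cover_growth _ A (ltn0Sn k) A_row R s C s0.
- move=> w /mapP[j]; rewrite mem_undup => /FD/cX[_ mi] ->.
  by rewrite size_mkseq.
- move=> x /FX[i iF ix]; exists (mkseq (c i) (m i)).
    by apply/mapP; exists i => //; rewrite mem_undup.
  by rewrite size_mkseq; apply/agreeP; exact: agree_sym.
- rewrite big_map; under eq_bigr do rewrite size_mkseq.
  rewrite -lee_fin (le_trans _ (ltW sumD))// -sumEFin; apply: esum_ge.
  exists [set` undup F]; last by rewrite fsbig_seq ?undup_uniq.
  by split=> [|i /=]; [exact: finite_seq|rewrite mem_undup => /FD].
rewrite -[leRHS]expRK ler_ln ?posrE ?spectral_radius_gt0 ?expR_gt0//.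
apply: spectral_radius_le => z /(words_lower_bound A01)[b b0 bP].
apply: (@ler_of_geometric _ _ _ b (K * expR s)) => // [|p]; first exact: expR_gt0.
rewrite (le_trans (bP p))// (le_trans (KP p.+1))//.
by rewrite -mulrA -exprS -expRM_natr.
Qed.

Lemma bowen_M_SigmaA_eq0 s : ln rho < s ->
  bowen_M X dist sigma_shift 0 X s 1 = 0%E.
Proof.
move=> rho_s; apply/bowen_M_eq0 => n.
apply: ereal_le0_eps => [|e e0]; first exact: bowen_M_n_ge0.
have rho0 := spectral_radius_gt0.
have rhos : rho < expR s by rewrite -[ltLHS]lnK ?posrE// ltr_expR.
have r0 : 0 < (rho + expR s) / 2 by lra.
have [K K0 KP] := words_upper_bound A01 r0 (ltac:(lra)).
set r := (rho + expR s) / 2 in r0 KP.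
(* The cylinders of length [N] cost at most [K (r / exp s)^N] in total. If this exceeded [e] for
   every [N > n], [ler_of_geometric] would give [exp s <= r]. *)
have [N nN KN] : exists2 N, (n < N)%N & K * r ^+ N <= e * expR s ^+ N.
  apply: contrapT => H.
  suff : expR s <= r by rewrite /r; lra.
  apply: (@ler_of_geometric _ _ _ (e * expR s ^+ n.+1) (K * r ^+ n.+1)) => // [|m].
    by rewrite mulr_gt0// exprn_gt0// expR_gt0.
  rewrite -!mulrA -!exprD leNgt; apply/negP => /ltW KN; apply: H.
  by exists (n.+1 + m)%N => //; rewrite ltnS leq_addr.
have N0 : (0 < N)%N by exact: leq_ltn_trans nN.
have [ext extP] := words_choice N.
apply: (@le_trans _ _ (\esum_(i in `I_(W N)) (expR (- s * N%:R))%:E)%E).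
  apply: ereal_inf_lbound.
  exists `I_(W N), (fun i => ext (nth [::] (words A N) i)), (fun=> N).
  split=> [i iW|]; first by split; [case: (extP _ (mem_nth [::] iW))|exact: ltnW].
  split=> // x xX; have xN := mkseq_words N xX.
  exists (index (mkseq x N) (words A N)); first by rewrite /= index_mem.
  split=> //; apply/(@dist_n_alpha_ltP R) => //; first exact: ltr01_ler11.
  by rewrite ball_depth_unit//; apply/agreeP; rewrite nth_index//; case: (extP _ xN).
rewrite esum_fset//.
rewrite -fsbig_ord sumEFin lee_fin sumr_const card_ord -[_ *+ W N]mulr_natl.
rewrite mulNr expRN ler_pdivrMr ?expR_gt0// expRM_natr.
exact: le_trans (KP N) KN.
Qed.

Lemma hausdorff_dim_SigmaA : hausdorff_dim X dist X = (ln rho)%:E.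
Proof.
have := @bowen_crit_hausdorff_dim R _ X 0 1 (lexx 0) ltr01_ler11 X SigmaA_nonempty
  (@subset_refl _ X).
rewrite addr0 mul1e => <-.
apply/eqP; rewrite eq_le; apply/andP; split.
  apply/lee_addgt0Pr => e e0; apply: ereal_inf_lbound.
  exists (ln rho + e) => //; split; last by apply: bowen_M_SigmaA_eq0; lra.
  by rewrite addr_ge0 ?(ltW e0)// ln_ge0// spectral_radius_ge1.
apply: le_ereal_inf_tmp => _ [s [s0 Hs] <-].
by rewrite lee_fin; exact: ln_spectral_radius_le.
Qed.

(** * Spanning numbers and topological entropy *)

Lemma span_number_SigmaA alpha eps n : 0 <= alpha -> 0 < eps <= 1 -> (0 < n)%N ->
  span_number X dist sigma_shift alpha n eps = ((W (ball_depth alpha eps n))%:R)%:E.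
Proof.
move=> a0 e01 n0; set L := ball_depth alpha eps n.
have [ext extP] := words_choice L.
apply/eqP; rewrite eq_le; apply/andP; split.
  pose E := [set` [seq ext w | w <- words A L]].
  have finE : finite_set E by exact: finite_seq.
  apply: (@le_trans _ _ ((#|` fset_set E|)%fset%:R)%:E).
    apply: ereal_inf_lbound; exists E => //; split=> //; split.
      by move=> _ /mapP[w /extP[wX _] ->].
    move=> x xX; have xL := mkseq_words L xX; exists (ext (mkseq x L)); split.
      by apply/mapP; exists (mkseq x L).
    apply/dist_n_alpha_ltP => //; apply/agreeP; rewrite -/L.
    by case: (extP _ xL).
  rewrite lee_fin ler_nat -(size_map ext (words A L)).
  apply: uniq_leq_size => [|x]; first exact: fset_uniq.
  by rewrite in_fset_set// inE.
apply: le_ereal_inf_tmp => _ [E [finE [EX spanE]] <-].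
(* Every admissible word of length [L] must occur as the prefix of a point of a spanning set. *)
rewrite lee_fin ler_nat -(size_map (fun x => mkseq x L) (fset_set E)).
apply: uniq_leq_size => [|w wL]; first exact: words_uniq.
have [wX wE] := extP w wL; have [y [Ey]] := spanE _ wX.
move=> /dist_n_alpha_ltP => /(_ a0 e01 n0)/agreeP; rewrite wE => wy.
by apply/mapP; exists y => //; rewrite in_fset_set// inE.
Qed.

(** The growth rates [rho exp(e)] and [rho exp(- e)] bound the count from above and below. The error
    is kept explicit for every [m] because the estimate is used at the depth of a Bowen ball. *)
Lemma ln_words_asymp e : 0 < e ->
  exists C, forall m, `|ln (W m)%:R - m%:R * ln rho| <= C + e * m%:R.
Proof.
move=> e0; have rho0 := spectral_radius_gt0.
have rho_gt (z : R) : z < rho -> exists2 v, eigenvalue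
     (map_mx (fun a : nat => (a%:R : R[i])) A) v & z < Normc.normc v.
  move=> zr; apply: contrapT => H; move: zr; apply/negP; rewrite -leNgt.
  apply: spectral_radius_le => v vM; rewrite leNgt; apply/negP => zv.
  by apply: H; exists v.
have exp_lt : rho * expR (- e) < rho.
  by rewrite -[ltRHS]mulr1 ltr_pM2l// -expR0 ltr_expR oppr_lt0.
have [z zM rz] := rho_gt _ exp_lt.
have z0 : 0 < Normc.normc z.
  by apply: lt_trans rz; rewrite mulr_gt0// expR_gt0.
have lnz : ln rho - e <= ln (Normc.normc z).
  rewrite -[X in _ - X]expRK -lnV ?posrE ?expR_gt0// -expRN -lnM ?posrE ?expR_gt0//.
  by rewrite ler_ln ?posrE ?mulr_gt0 ?expR_gt0// ltW.
have [c c0 cP] := words_lower_bound A01 zM.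
have re0 : 0 < rho * expR e by rewrite mulr_gt0// expR_gt0.
have [|K K0 KP] := words_upper_bound A01 re0.
  by rewrite -[ltLHS]mulr1 ltr_pM2l// -expR0 ltr_expR.
have lnrho0 := ln_ge0 spectral_radius_ge1.
(* The term [ln rho] absorbs the index shift of [words_lower_bound], where words of length [m + 1]
   are compared with the power [m]. *)
exists (`|ln K| + `|ln c| + ln rho) => m.
have W0 m' : 0 < (W m')%:R :> R by rewrite (lt_le_trans ltr01)// natr_words_ge1.
have em : 0 <= e * m%:R by rewrite mulr_ge0// ltW.
have := ler_norm (ln K); have := ler_norm (- ln c); rewrite normrN => hc hK.
have hc0 := normr_ge0 (ln c); have hK0 := normr_ge0 (ln K).
rewrite ler_norml; apply/andP; split; last first.
  have : ln (W m)%:R <= ln (K * (rho * expR e) ^+ m).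
    by rewrite ler_ln ?posrE ?mulr_gt0 ?exprn_gt0.
  rewrite lnM ?posrE ?exprn_gt0// lnXn// lnM ?posrE ?expR_gt0// expRK.
  rewrite -[_ *+ m]mulr_natl mulrDr [m%:R * e]mulrC; lra.
case: m em => [|m] em.
  by rewrite /= ln1 mul0r; lra.
have : ln (c * Normc.normc z ^+ m) <= ln (W m.+1)%:R.
  by rewrite ler_ln ?posrE ?mulr_gt0 ?exprn_gt0.
rewrite lnM ?posrE ?exprn_gt0// lnXn// -[_ *+ m]mulr_natl.
have /(ler_wpM2l (ler0n R m)) := lnz.
rewrite -natr1; set v : R := m%:R; set w : R := ln (W m.+1)%:R; lra.
Qed.

Lemma span_number_growth alpha eps : 0 <= alpha -> 0 < eps <= 1 ->
  (ln (fine (span_number X dist sigma_shift alpha n eps)) / n%:R) @[n --> \oo] -->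
  (1 + alpha) * ln rho.
Proof.
move=> a0 e01; have [e0 e1] := andP e01; have leps := ln_le0 e1.
have a1 : 0 < 1 + alpha by rewrite ltr_pwDl.
apply/cvgrPdist_le => e e_gt0.
(* The tolerance [e / (2 (1 + alpha))], at depth about [(1 + alpha) n], costs about [e n / 2]; the
   other half is left for the constants. *)
have [C CP] := ln_words_asymp (divr_gt0 e_gt0 (mulr_gt0 (ltr0Sn R 1) a1)).
set e' := e / _ in CP; have e'0 : 0 < e' by rewrite divr_gt0// mulr_gt0.
have lnrho0 := ln_ge0 spectral_radius_ge1.
(* This bounds the difference between the ball depth and [(1 + alpha) n]. *)
pose b := 1 + alpha - ln eps + 1.
near=> n.
have n0 : (0 < n)%N by near: n; exact: nbhs_infty_gt.
have nC : (C + e' * b + b * ln rho) * 2 / e <= n%:R.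
  near: n; exact: nbhs_infty_ger.
have nR0 : 0 < n%:R :> R by rewrite ltr0n.
rewrite span_number_SigmaA//= distrC.
have -> : ln (W (ball_depth alpha eps n))%:R / n%:R - (1 + alpha) * ln rho =
  (ln (W (ball_depth alpha eps n))%:R - n%:R * ((1 + alpha) * ln rho)) / n%:R.
  by field; rewrite gt_eqF.
rewrite normrM normfV (gtr0_norm nR0) ler_pdivrMr//.
have := CP (ball_depth alpha eps n).
have := ball_depth_gt alpha eps n; have := ball_depth_le n a0 e01.
rewrite -subn1 natrB//.
set L : R := (ball_depth alpha eps n)%:R; set w := ln (W _)%:R; set v : R := n%:R.
move=> Lle /ltW Lge wL.
have Lb : `|L - (1 + alpha) * v| <= b by rewrite /b ler_norml; apply/andP; split; lra.
have -> : w - v * ((1 + alpha) * ln rho) =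
  (w - L * ln rho) + (L - (1 + alpha) * v) * ln rho by ring.
rewrite (le_trans (ler_normD _ _))// normrM (ger0_norm lnrho0).
have h1 : `|L - (1 + alpha) * v| * ln rho <= b * ln rho by rewrite ler_wpM2r.
have h2 : e' * L <= e' * (b + (1 + alpha) * v).
  by rewrite ler_wpM2l ?(ltW e'0)//; move: Lb; rewrite ler_norml => /andP[_]; lra.
have h3 : e' * ((1 + alpha) * v) = e * v / 2.
  by rewrite /e'; field; rewrite gt_eqF.
have h4 : C + e' * b + b * ln rho <= e * v / 2.
  by move: nC; rewrite ler_pdivrMr// -/v; lra.
lra.
Unshelve. all: by end_near.
Qed.

(** The upper limit is a genuine limit, with the same value at every [0 < eps <= 1]. *)
Lemma top_entropy_SigmaA alpha : 0 <= alpha ->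
  top_entropy X dist sigma_shift alpha = ((1 + alpha) * ln rho)%:E.
Proof.
move=> a0; apply: lim_near_cst; first exact: ereal_hausdorff.
near=> eps.
have e01 : 0 < eps <= 1.
  by apply/andP; split; near: eps; [exact: nbhs_right_gt|exact: nbhs_right_le].
apply: (cvg_limn_einf_sup _).2; apply: cvg_EFin; last exact: span_number_growth.
by near=> n.
Unshelve. all: by end_near.
Qed.

End SubshiftDimension.

Unset Implicit Arguments.

Theorem theorem1p4 (R : realType) (k : nat) (A : 'M[nat]_k) :
  (0 < k)%N ->
  (forall i j, A i j = 0%N \/ A i j = 1%N) ->
  (forall i, exists j, A i j = 1%N) ->
  forall alpha : R, 0 <= alpha ->
    (forall E : set (seqk k), E `<=` SigmaA A ->
       hausdorff_dim (SigmaA A) (@shift_dist R k) E =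
       (bowen_entropy (SigmaA A) (@shift_dist R k) sigma_shift alpha E
          * ((1 + alpha)^-1)%:E)%E) /\
    bowen_entropy (SigmaA A) (@shift_dist R k) sigma_shift alpha (SigmaA A) =
      top_entropy (SigmaA A) (@shift_dist R k) sigma_shift alpha /\
    top_entropy (SigmaA A) (@shift_dist R k) sigma_shift alpha =
      ((1 + alpha) * ln (@spectral_radius R k A))%:E /\
    hausdorff_dim (SigmaA A) (@shift_dist R k) (SigmaA A) =
      (ln (@spectral_radius R k A))%:E.
Proof.
(* Matrix powers use the ring structure of square matrices of size [k.+1]. *)
case: k A => // k A _ A01 A_row alpha a0.
have a1 : 1 + alpha != 0 by rewrite gt_eqF// ltr_pwDl.
have X0 := SigmaA_nonempty A_row.
split=> [E EX|].
  rewrite bowen_entropy_hausdorff_dim// muleAC -EFinM divff// mul1e//.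
rewrite bowen_entropy_hausdorff_dim// hausdorff_dim_SigmaA// top_entropy_SigmaA//.
Qed.
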